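(* Suppose that $q\in(0,1)$, and that $a\neq 0$ and $b$ are real numbers with $b<0$ and $|b|>|a|$. Let $f\in C([0,\infty);\mathbb{R})$, let $\zeta\in\mathbb{R}$, and let $x$ be the unique continuous solution of $$x'(t)=ax(qt)+bx(t)+f(t),\quad t\ge 0;\qquad x(0)=\zeta .$$ Let $y$ be the unique continuous solution of $y'(t)=-y(t)+f(t)$, $t\ge 0$, $y(0)=0$. Then the following are equivalent: (A) $y(t)\to 0$ as $t\to\infty$; (B) for every $\theta>0$, $\lim_{t\to\infty}\int_t^{t+\theta} f(s)\,ds=0$; (C) $x(t)\to 0$ as $t\to\infty$.
   Context: All functions are real valued and defined on $[0,\infty)$. Explicitly, $y(t)=\int_0^t e^{-(t-s)}f(s)\,ds$. *)

(* Defs.v *)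
From Stdlib Require Import Reals.
From Coquelicot Require Import Coquelicot.
Open Scope R_scope.

(* A function on [0, +oo) is represented by an [R -> R] of which only the
   values on this set matter. *)
Definition halfline (t : R) : Prop := 0 <= t.

(* [is_derive] with the filter restricted to [0, +oo): the ordinary derivative
   at [t > 0], the right-hand derivative at [t = 0]. *)
Definition is_derive_halfline (u : R -> R) (t l : R) : Prop :=
  filterdiff u (within halfline (locally t)) (fun h => scal h l).

Definition pantograph_solution (q a b : R) (f : R -> R) (zeta : R)
    (x : R -> R) : Prop :=
  continuous_on halfline x /\
  (forall t, 0 <= t ->
     is_derive_halfline x t (a * x (q * t) + b * x t + f t)) /\
  x 0 = zeta.

Definition relaxation_solution (f y : R -> R) : Prop :=
  continuous_on halfline y /\
  (forall t, 0 <= t -> is_derive_halfline y t (- y t + f t)) /\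
  y 0 = 0.

(* Main.v *)
Require Import Defs.
From Stdlib Require Import Reals.
From Coquelicot Require Import Coquelicot.
From Stdlib Require Import Lra Lia Classical ClassicalEpsilon.
Open Scope R_scope.

(** Condition (B), that the integral of [f] over every window
    [[t, t + theta]] tends to 0, is a property of [f] alone.  The point is
    that it characterises the convergence to 0 of any solution of
    [x'(t) = a x(qt) + b x(t) + f(t)] with [b < 0] and [|a| < -b]
    ([pantograph_tends_to_zero_iff]).  The function [y] of (A) solves the
    equation with [a = 0] and [b = -1], so one equivalence, applied to [y] and
    to [x], gives the whole theorem.

    If [x] tends to 0, integrating the equation over a window writes the
    integral of [f] as an increment of [x] minus the integral of a function
    that tends to 0.

    Conversely, (B) says that the primitive [F] of [f] satisfies
    [F(t + theta) - F(t) -> 0] for each [theta].  This pointwise statement is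
    automatically uniform for [theta] in [[0, 1]]
    ([increments_vanish_uniformly]): as in Karamata's uniform convergence
    theorem for slowly varying functions, a Baire category argument gives
    uniformity on some interval of values of [theta], and differences of
    increments move this interval to 0.  Hence [p = F - A], where [A(t)] is the
    mean of [F] over [[t, t + 1]], tends to 0, and so does
    [g(t) = A'(t) = F(t + 1) - F(t)].  Thus [f = p' + g] with [p] and [g]
    vanishing at infinity ([vanishing_windows_decomposition]).  The difference
    [z = x - p] solves the pantograph equation with the vanishing forcing
    [a p(qt) + b p(t) + g(t)], and then [z] tends to 0 because the damping
    [b] dominates the delayed term ([pantograph_vanishing_forcing]). *)

(** * Limits at infinity, continuity and integrals *)

Lemma is_lim_p_infty_0_iff (u : R -> R) :
  is_lim u p_infty 0 <->
  (forall eps, 0 < eps ->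
     exists T, 0 < T /\ forall t, T <= t -> Rabs (u t) <= eps).
Proof.
split; intros H.
- intros eps Heps.
  apply is_lim_spec in H.
  destruct (H (mkposreal eps Heps)) as [M HM]; simpl in HM.
  exists (Rmax M 0 + 1).
  generalize (Rmax_l M 0) (Rmax_r M 0); intros Hl Hr.
  split; [lra|].
  intros t Ht.
  generalize (HM t ltac:(lra)); rewrite Rminus_0_r; lra.
- apply is_lim_spec; intros eps.
  destruct (H (eps / 2)) as [T [_ HT]]; [destruct eps; simpl; lra|].
  exists T; intros t Ht.
  rewrite Rminus_0_r.
  generalize (HT t ltac:(lra)); destruct eps; simpl; lra.
Qed.

Lemma ex_RInt_everywhere_continuous (u : R -> R) (c d : R) :
  (forall t, continuous u t) -> ex_RInt u c d.
Proof.
intros H; apply (ex_RInt_continuous (V := R_CompleteNormedModule)); auto.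
Qed.

Lemma continuous_comp_affine (u : R -> R) (c d t : R) :
  (forall s, continuous u s) -> continuous (fun s => u (c * s + d)) t.
Proof.
intros H.
apply (continuous_comp (fun s => c * s + d) u); [|apply H].
apply (ex_derive_continuous (fun s => c * s + d)); auto_derive; auto.
Qed.

Lemma continuous_bounded_segment (u : R -> R) (c d : R) :
  c <= d -> (forall t, continuous u t) ->
  exists s, c <= s <= d /\ forall t, c <= t <= d -> Rabs (u t) <= Rabs (u s).
Proof.
intros Hcd H.
destruct (continuity_ab_maj (fun t => Rabs (u t)) c d Hcd) as [s [Hs1 Hs2]].
- intros t _.
  apply continuity_pt_filterlim.
  apply (continuous_comp u Rabs); [apply H|].
  apply continuity_pt_filterlim, Rcontinuity_abs.
- exists s; split; [exact Hs2|exact Hs1].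
Qed.

Lemma continuous_vanishing_bounded (u : R -> R) :
  (forall t, continuous u t) -> is_lim u p_infty 0 ->
  exists M, forall t, 0 <= t -> Rabs (u t) <= M.
Proof.
intros Hc Hl.
destruct (proj1 (is_lim_p_infty_0_iff u) Hl 1 Rlt_0_1) as [T [HT0 HT]].
destruct (continuous_bounded_segment u 0 T ltac:(lra) Hc) as [s [_ Hs]].
exists (Rabs (u s) + 1); intros t Ht.
generalize (Rabs_pos (u s)); intros Hp.
destruct (Rle_dec T t) as [H|H].
- generalize (HT t H); lra.
- generalize (Hs t ltac:(lra)); lra.
Qed.

Lemma continuous_abs_RInt_le_const (u : R -> R) (c d M : R) :
  c <= d -> (forall t, continuous u t) ->
  (forall t, c <= t <= d -> Rabs (u t) <= M) ->
  Rabs (RInt u c d) <= (d - c) * M.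
Proof.
intros Hcd Hc HM.
apply abs_RInt_le_const; auto.
apply ex_RInt_everywhere_continuous, Hc.
Qed.

Lemma RInt_window_vanishes (h : R -> R) (theta : R) :
  0 < theta -> (forall t, continuous h t) -> is_lim h p_infty 0 ->
  is_lim (fun t => RInt h t (t + theta)) p_infty 0.
Proof.
intros Hth Hc Hl.
apply is_lim_p_infty_0_iff; intros eps Heps.
destruct (proj1 (is_lim_p_infty_0_iff h) Hl (eps / theta)) as [T [HT0 HT]].
{ now apply Rdiv_lt_0_compat. }
exists T; split; auto; intros t Ht.
replace eps with ((t + theta - t) * (eps / theta)) by (field; lra).
apply continuous_abs_RInt_le_const; auto; [lra|].
intros s Hs; apply HT; lra.
Qed.

(** * Stability of the pantograph equation under vanishing forcing *)

(** Gronwall comparison with the solution of [v' = b v + M]:  the function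
    [exp (- b (s - T)) * (u s - M / - b)] is nonincreasing. *)
Lemma relaxation_upper_bound (b M T t : R) (u h : R -> R) :
  b < 0 -> T <= t -> (forall s, continuous u s) ->
  (forall s, T < s < t -> is_derive u s (b * u s + h s)) ->
  (forall s, T <= s <= t -> h s <= M) ->
  u t <= exp (b * (t - T)) * (u T - M / - b) + M / - b.
Proof.
intros Hb HTt Hc Hd HM.
set (phi := fun s => exp (- b * (s - T)) * (u s - M / - b)).
assert (Hphi : phi t <= phi T).
{ destruct (MVT_gen phi T t
    (fun s => exp (- b * (s - T)) * (h s - M))) as [s [Hs Heq]].
  - rewrite Rmin_left, Rmax_right by lra; intros s Hs.
    unfold phi; auto_derive.
    + exists (b * u s + h s); now apply Hd.
    + replace (Derive (fun x => u x) s) with (b * u s + h s)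
        by (symmetry; apply is_derive_unique, Hd; lra).
      unfold Rminus; field; lra.
  - intros s _; apply continuity_pt_filterlim.
    apply (continuous_mult (fun s => exp (- b * (s - T)))
                           (fun s => u s - M / - b)).
    + apply (ex_derive_continuous (fun s => exp (- b * (s - T))));
        auto_derive; auto.
    + apply (continuous_minus u (fun _ => M / - b)); auto.
      apply continuous_const.
  - rewrite Rmin_left, Rmax_right in Hs by lra.
    assert (0 <= exp (- b * (s - T)) * (M - h s) * (t - T)).
    { apply Rmult_le_pos; [apply Rmult_le_pos|]; try lra.
      - apply Rlt_le, exp_pos.
      - generalize (HM s Hs); lra. }
    lra. }
unfold phi in Hphi.
replace (- b * (T - T)) with 0 in Hphi by ring.
rewrite exp_0, Rmult_1_l in Hphi.
apply (Rmult_le_compat_l (exp (b * (t - T)))) in Hphi;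
  [|apply Rlt_le, exp_pos].
rewrite <- Rmult_assoc, <- exp_plus in Hphi.
replace (b * (t - T) + - b * (t - T)) with 0 in Hphi by ring.
rewrite exp_0 in Hphi; lra.
Qed.

Lemma relaxation_bound (b M T t : R) (u h : R -> R) :
  b < 0 -> T <= t -> (forall s, continuous u s) ->
  (forall s, T < s < t -> is_derive u s (b * u s + h s)) ->
  (forall s, T <= s <= t -> Rabs (h s) <= M) ->
  Rabs (u t) <= exp (b * (t - T)) * (Rabs (u T) - M / - b) + M / - b.
Proof.
intros Hb HTt Hc Hd HM.
assert (Hup : u t <= exp (b * (t - T)) * (u T - M / - b) + M / - b).
{ apply relaxation_upper_bound with h; auto.
  intros s Hs; generalize (Rle_abs (h s)) (HM s Hs); lra. }
assert (Hlow : - u t <= exp (b * (t - T)) * (- u T - M / - b) + M / - b).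
{ apply (relaxation_upper_bound b M T t (fun s => - u s) (fun s => - h s));
    auto.
  - intros s; apply (continuous_opp u), Hc.
  - intros s Hs.
    replace (b * - u s + - h s) with (- (b * u s + h s)) by ring.
    apply (is_derive_opp u); auto.
  - intros s Hs; generalize (Rabs_maj2 (h s)) (HM s Hs); lra. }
generalize (exp_pos (b * (t - T))); intros He.
assert (exp (b * (t - T)) * u T <= exp (b * (t - T)) * Rabs (u T)).
{ apply Rmult_le_compat_l; [lra|apply Rle_abs]. }
assert (exp (b * (t - T)) * - u T <= exp (b * (t - T)) * Rabs (u T)).
{ apply Rmult_le_compat_l; [lra|apply Rabs_maj2]. }
apply Rabs_le; lra.
Qed.

Definition eventually_below (u : R -> R) (k : R) : Prop :=
  exists T, 0 < T /\ forall t, T <= t -> Rabs (u t) <= k.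

(** Iterating [k |-> rho k + delta] brings the bound as close as desired to its
    fixed point [delta / (1 - rho)], which is arbitrarily small. *)
Lemma eventually_below_contraction_lim (u : R -> R) (rho k0 : R) :
  0 <= rho < 1 -> eventually_below u k0 ->
  (forall k delta, eventually_below u k -> 0 < delta ->
     eventually_below u (rho * k + delta)) ->
  is_lim u p_infty 0.
Proof.
intros Hrho H0 Hstep.
apply is_lim_p_infty_0_iff; intros eps Heps.
(* The choice [delta = (1 - rho) eps / 2] puts the fixed point at [eps / 2]. *)
assert (Hn : forall n, eventually_below u (rho ^ n * (k0 - eps / 2) + eps / 2)).
{ induction n as [|n IH].
  - simpl; replace (1 * (k0 - eps / 2) + eps / 2) with k0 by lra; exact H0.
  - replace (rho ^ S n * (k0 - eps / 2) + eps / 2)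
      with (rho * (rho ^ n * (k0 - eps / 2) + eps / 2)
            + (1 - rho) * (eps / 2)) by (simpl; ring).
    apply Hstep; auto; apply Rmult_lt_0_compat; lra. }
generalize (Rabs_pos k0) (Rle_abs k0); intros Hk Hk'.
destruct (pow_lt_1_zero rho ltac:(rewrite Rabs_pos_eq; lra)
  (eps / 2 / (Rabs k0 + 1))) as [N HN].
{ apply Rdiv_lt_0_compat; lra. }
specialize (HN N (le_n N)).
destruct (Hn N) as [T [HT0 HT]].
exists T; split; auto; intros t Ht.
apply Rle_trans with (1 := HT t Ht).
assert (Hr : 0 <= rho ^ N) by (apply pow_le; lra).
rewrite Rabs_pos_eq in HN by exact Hr.
assert (rho ^ N * (Rabs k0 + 1) <= eps / 2).
{ apply Rlt_le in HN.
  apply (Rmult_le_compat_r (Rabs k0 + 1)) in HN; [|lra].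
  replace (eps / 2 / (Rabs k0 + 1) * (Rabs k0 + 1)) with (eps / 2) in HN
    by (field; lra).
  exact HN. }
assert (rho ^ N * (k0 - eps / 2) <= rho ^ N * (Rabs k0 + 1)).
{ apply Rmult_le_compat_l; lra. }
lra.
Qed.

Lemma exp_decay (b eps : R) :
  b < 0 -> 0 < eps -> exists S, 0 < S /\ forall s, S <= s -> exp (b * s) <= eps.
Proof.
intros Hb He.
exists (Rmax 1 (ln eps / b)); split.
- generalize (Rmax_l 1 (ln eps / b)); lra.
- intros s Hs.
  rewrite <- (exp_ln eps He).
  assert (H : b * s <= ln eps).
  { assert (ln eps / b <= s) by (generalize (Rmax_r 1 (ln eps / b)); lra).
    replace (ln eps) with (b * (ln eps / b)) by (field; lra).
    apply Rmult_le_compat_neg_l; lra. }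
  destruct H as [H|H]; [left; now apply exp_increasing|rewrite H; lra].
Qed.

(** Let [m] be the maximum of [|z|] on [[0, t]], attained at [s].  The delayed
    argument stays in [[0, t]], so the comparison at [s] gives
    [m <= Rmax |z 0| ((|a| m + M) / - b)], and [|a| < - b] lets [m] be absorbed:
    the resulting bound is independent of [t]. *)
Lemma pantograph_bounded (q a b : R) (z g : R -> R) (M : R) :
  0 < q < 1 -> b < 0 -> Rabs a < - b ->
  (forall t, continuous z t) ->
  (forall t, 0 < t -> is_derive z t (a * z (q * t) + b * z t + g t)) ->
  (forall t, 0 <= t -> Rabs (g t) <= M) ->
  exists K, forall t, 0 <= t -> Rabs (z t) <= K.
Proof.
intros Hq Hb Hab Hc Hd HM.
assert (HM0 : 0 <= M).
{ generalize (HM 0 (Rle_refl 0)) (Rabs_pos (g 0)); lra. }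
exists (Rmax (Rabs (z 0)) (M / (- b - Rabs a))); intros t Ht.
destruct (continuous_bounded_segment z 0 t Ht Hc) as [s [Hs Hmax]].
apply Rle_trans with (1 := Hmax t ltac:(lra)).
set (m := Rabs (z s)) in *.
assert (Hbound : m <= exp (b * (s - 0))
    * (Rabs (z 0) - (Rabs a * m + M) / - b) + (Rabs a * m + M) / - b).
{ apply (relaxation_bound b _ 0 s z (fun r => a * z (q * r) + g r));
    auto; try lra.
  - intros r Hr.
    replace (b * z r + (a * z (q * r) + g r))
      with (a * z (q * r) + b * z r + g r) by ring.
    apply Hd; lra.
  - intros r Hr.
    apply Rle_trans with (1 := Rabs_triang _ _).
    rewrite Rabs_mult.
    apply Rplus_le_compat; [|apply HM; lra].
    apply Rmult_le_compat_l; [apply Rabs_pos|].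
    apply Hmax; nra. }
generalize (exp_pos (b * (s - 0))); intros He.
assert (He1 : exp (b * (s - 0)) <= 1).
{ rewrite <- exp_0.
  destruct (Req_dec s 0) as [->|Hs0].
  - right; f_equal; ring.
  - left; apply exp_increasing; nra. }
set (e := exp (b * (s - 0))) in *.
set (c := (Rabs a * m + M) / - b) in *.
destruct (Rle_dec c (Rabs (z 0))) as [Hle|Hgt].
- apply Rle_trans with (2 := Rmax_l _ _); nra.
- apply Rle_trans with (2 := Rmax_r _ _).
  assert (Hmc : m <= c) by nra.
  unfold c in Hmc.
  apply Rle_div_r in Hmc; [|lra].
  apply Rle_div_r; lra.
Qed.

(** Once [|z| <= k] from time [T] on, the delayed term is at most [|a| k] from
    time [T / q] on, and relaxation at rate [- b] brings [|z|] below
    [(|a| / - b) k + delta].  Since [|a| / - b < 1], this contracts every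
    eventual bound. *)
Lemma pantograph_vanishing_forcing (q a b : R) (z g : R -> R) :
  0 < q < 1 -> b < 0 -> Rabs a < - b ->
  (forall t, continuous z t) -> (forall t, continuous g t) ->
  (forall t, 0 < t -> is_derive z t (a * z (q * t) + b * z t + g t)) ->
  is_lim g p_infty 0 -> is_lim z p_infty 0.
Proof.
intros Hq Hb Hab Hcz Hcg Hd Hg.
destruct (continuous_vanishing_bounded g Hcg Hg) as [M HM].
destruct (pantograph_bounded q a b z g M) as [K HK]; auto.
generalize (Rabs_pos a); intros Ha.
apply (eventually_below_contraction_lim z (Rabs a / - b) K).
- split; [apply Rle_div_r; lra|].
  apply (Rmult_lt_reg_r (- b)); [lra|].
  unfold Rdiv; rewrite Rmult_assoc, Rinv_l; lra.
- exists 1; split; [lra|]; intros t Ht; apply HK; lra.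
- intros k delta [T [HT0 HT]] Hdelta.
  destruct (proj1 (is_lim_p_infty_0_iff g) Hg (- b * (delta / 2)))
    as [T' [HT'0 HT']].
  { apply Rmult_lt_0_compat; lra. }
  set (T1 := T / q + T').
  assert (HTq : T <= T / q).
  { apply Rle_div_r; [lra|]; nra. }
  assert (HK0 : 0 <= K).
  { generalize (HK 0 (Rle_refl 0)) (Rabs_pos (z 0)); lra. }
  assert (Hk0 : 0 <= k).
  { generalize (HT T (Rle_refl T)) (Rabs_pos (z T)); lra. }
  destruct (exp_decay b (delta / 2 / (K + 1))) as [S [HS0 HS]]; auto.
  { apply Rdiv_lt_0_compat; lra. }
  exists (T1 + S); split; [unfold T1; lra|]; intros t Ht.
  set (N := Rabs a * k + - b * (delta / 2)).
  assert (Hb' : Rabs (z t) <= exp (b * (t - T1))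
    * (Rabs (z T1) - N / - b) + N / - b).
  { apply (relaxation_bound b N T1 t z (fun r => a * z (q * r) + g r));
      auto; try lra.
    - intros r Hr.
      replace (b * z r + (a * z (q * r) + g r))
        with (a * z (q * r) + b * z r + g r) by ring.
      apply Hd; unfold T1 in Hr; lra.
    - intros r Hr; unfold T1 in Hr.
      apply Rle_trans with (1 := Rabs_triang _ _).
      rewrite Rabs_mult.
      apply Rplus_le_compat; [|apply HT'; lra].
      apply Rmult_le_compat_l; [apply Rabs_pos|].
      apply HT.
      replace T with (q * (T / q)) by (field; lra).
      apply Rmult_le_compat_l; lra. }
  assert (HN : N / - b = Rabs a / - b * k + delta / 2).
  { unfold N; field; lra. }
  assert (HN0 : 0 <= N / - b).
  { apply Rdiv_le_0_compat; [|lra]; unfold N.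
    generalize (Rmult_le_pos _ _ Ha Hk0); nra. }
  generalize (HS (t - T1) ltac:(lra)) (exp_pos (b * (t - T1))); intros He He0.
  assert (exp (b * (t - T1)) * (Rabs (z T1) - N / - b) <= delta / 2).
  { apply Rle_trans with (exp (b * (t - T1)) * (K + 1)).
    - apply Rmult_le_compat_l; [lra|].
      generalize (HK T1 ltac:(unfold T1; lra)); lra.
    - apply Rle_div_r in He; lra. }
  lra.
Qed.

(** * Uniformity of vanishing increments *)

(** Baire category theorem on a segment.  If no [C n] contained a segment, every
    segment would contain a smaller one disjoint from [C n]; nesting these
    produces a point outside all the [C n]. *)
Lemma closed_cover_contains_segment (C : nat -> R -> Prop) (c d : R) :
  (forall n, closed (C n)) -> c < d ->
  (forall s, c <= s <= d -> exists n, C n s) ->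
  exists n alpha beta, c <= alpha /\ alpha < beta /\ beta <= d /\
    forall s, alpha <= s <= beta -> C n s.
Proof.
intros Hclosed Hcd Hcover.
apply NNPP; intros Hno.
assert (Hstep : forall (n : nat) (I : R * R), exists J : R * R,
  c <= fst I /\ fst I < snd I /\ snd I <= d ->
  fst I <= fst J /\ fst J < snd J /\ snd J <= snd I /\
  forall s, fst J <= s <= snd J -> ~ C n s).
{ intros n [l r]; simpl.
  destruct (classic (c <= l /\ l < r /\ r <= d)) as [H|H];
    [|exists (0, 0); tauto].
  destruct (classic (exists s, l < s < r /\ ~ C n s)) as [[s [Hs Hns]]|Hall].
  - assert (Hloc : locally s (fun s => ~ C n s)).
    { apply NNPP; intros Hnl; apply Hns, Hclosed, Hnl. }
    destruct Hloc as [eta Heta].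
    generalize (cond_pos eta); intros He.
    set (m := Rmin (eta / 2) (r - s)).
    assert (Hm : 0 < m /\ m <= eta / 2 /\ m <= r - s).
    { unfold m; repeat split; [apply Rmin_pos; lra|apply Rmin_l|apply Rmin_r]. }
    exists (s, s + m); simpl; intros _.
    repeat split; try lra.
    intros s' Hs'; apply Heta.
    apply Rabs_lt_between'; lra.
  - exfalso; apply Hno.
    exists n, ((2 * l + r) / 3), ((l + 2 * r) / 3).
    repeat split; try lra.
    intros s Hs; apply NNPP; intros Hns; apply Hall.
    exists s; split; [lra|exact Hns]. }
(* [Hstep] is total in [I], with a junk value outside [[c, d]], so that a
   choice function can be iterated. *)
set (next := fun n I => proj1_sig (constructive_indefinite_description _ (Hstep n I))).
set (seg := fix seg n := match n with
                         | O => (c, d)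
                         | S n => next n (seg n)
                         end).
assert (Hnext : forall n I, c <= fst I /\ fst I < snd I /\ snd I <= d ->
  fst I <= fst (next n I) /\ fst (next n I) < snd (next n I) /\
  snd (next n I) <= snd I /\
  forall s, fst (next n I) <= s <= snd (next n I) -> ~ C n s).
{ intros n I; unfold next.
  exact (proj2_sig (constructive_indefinite_description _ (Hstep n I))). }
assert (Hseg : forall n,
  c <= fst (seg n) /\ fst (seg n) < snd (seg n) /\ snd (seg n) <= d).
{ induction n as [|n IH]; simpl; [lra|].
  generalize (Hnext n (seg n) IH); lra. }
assert (Hmono : forall n k, fst (seg n) <= fst (seg (n + k)%nat)
  /\ snd (seg (n + k)%nat) <= snd (seg n)).
{ intros n k; induction k as [|k IH].
  - rewrite Nat.add_0_r; lra.
  - rewrite Nat.add_succ_r; simpl.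
    generalize (Hnext (n + k)%nat _ (Hseg (n + k)%nat)); lra. }
destruct (completeness (fun l => exists n, l = fst (seg n))) as [s [Hub Hlub]].
- exists d; intros l [n ->]; generalize (Hseg n); lra.
- exists c, 0%nat; reflexivity.
- assert (Hin : forall n, fst (seg n) <= s <= snd (seg n)).
  { intros n; split.
    - apply Hub; now exists n.
    - apply Hlub; intros l [m ->].
      destruct (Nat.le_ge_cases n m) as [Hnm|Hmn].
      + replace m with (n + (m - n))%nat by lia.
        generalize (Hmono n (m - n)%nat) (Hseg (n + (m - n))%nat); lra.
      + replace n with (m + (n - m))%nat by lia.
        generalize (Hmono m (n - m)%nat) (Hseg (m + (n - m))%nat); lra. }
  destruct (Hcover s) as [n Hn].
  { generalize (Hin 0%nat); simpl; lra. }
  apply (Hnext n (seg n) (Hseg n)) with (2 := Hn).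
  exact (Hin (S n)).
Qed.

Lemma closed_increment_bound (F : R -> R) (T eps : R) :
  (forall t, continuous F t) ->
  closed (fun s => forall t, T <= t -> Rabs (F (t + s) - F t) <= eps).
Proof.
intros Hc s Hs t Ht.
apply Rnot_lt_le; intros Hlt; apply Hs.
assert (Hcs : continuous (fun s => Rabs (F (t + s) - F t)) s).
{ apply (continuous_comp (fun s => F (t + s) - F t) Rabs).
  - apply (continuous_minus (fun s => F (t + s)) (fun _ => F t)).
    + apply (continuous_ext (fun s => F (1 * s + t))).
      * intros r; f_equal; ring.
      * now apply continuous_comp_affine.
    + apply continuous_const.
  - apply continuity_pt_filterlim, Rcontinuity_abs. }
assert (Hgt := Hcs _ (open_gt eps _ Hlt)); unfold filtermap in Hgt.
revert Hgt; apply filter_imp.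
intros r Hr Hall; generalize (Hall t Ht); lra.
Qed.

(** The closed sets of [s] in [[1, 2]] such that [|F (t + s) - F t| <= eps / 3]
    for all [t >= n] cover [[1, 2]], so one of them contains a segment
    [[alpha, beta]].  Subtracting the increments over [alpha + r] and [alpha]
    from the base point [t - alpha] bounds the increment over any [r] in
    [[0, beta - alpha]]. *)
Lemma increments_vanish_uniformly (F : R -> R) :
  (forall t, continuous F t) ->
  (forall theta, 0 < theta -> is_lim (fun t => F (t + theta) - F t) p_infty 0) ->
  forall eps, 0 < eps ->
  exists T, 0 < T /\ forall t s, T <= t -> 0 <= s <= 1 ->
    Rabs (F (t + s) - F t) <= eps.
Proof.
intros Hc Hlim eps Heps.
destruct (closed_cover_contains_segment
  (fun n s => forall t, INR n <= t -> Rabs (F (t + s) - F t) <= eps / 3) 1 2)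
  as [n [alpha [beta [H1 [H2 [H3 H4]]]]]].
- intros n; now apply closed_increment_bound.
- lra.
- intros s Hs.
  destruct (proj1 (is_lim_p_infty_0_iff _) (Hlim s ltac:(lra)) (eps / 3))
    as [T [HT0 HT]]; [lra|].
  destruct (nfloor_ex T ltac:(lra)) as [n Hn].
  exists (S n); intros t Ht; apply HT.
  rewrite S_INR in Ht; lra.
- set (eta := beta - alpha).
  assert (Hshort : forall t r, INR n + alpha <= t -> 0 <= r <= eta ->
    Rabs (F (t + r) - F t) <= 2 * (eps / 3)).
  { intros t r Ht Hr.
    generalize (H4 (alpha + r) ltac:(unfold eta in Hr; lra) (t - alpha) ltac:(lra))
      (H4 alpha ltac:(lra) (t - alpha) ltac:(lra)).
    replace (t - alpha + (alpha + r)) with (t + r) by ring.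
    replace (t - alpha + alpha) with t by ring.
    intros Ha Hb; apply Rabs_le_between in Ha; apply Rabs_le_between in Hb.
    apply Rabs_le_between; lra. }
  (* Extending the range of increments by [eta] costs nothing: the increment
     over [INR m * eta] is controlled afresh by pointwise convergence, instead
     of being accumulated. *)
  assert (Hmany : forall m, exists T, 0 < T /\ forall t s, T <= t ->
    0 <= s <= INR m * eta -> Rabs (F (t + s) - F t) <= eps).
  { induction m as [|m [T [HT0 HT]]].
    - exists 1; split; [lra|]; intros t s _ Hs; simpl in Hs.
      replace (t + s) with t by lra.
      rewrite Rminus_diag, Rabs_R0; lra.
    - destruct (Req_dec (INR m * eta) 0) as [Hz|Hz].
      + exists (INR n + alpha); split; [generalize (pos_INR n); lra|].
        intros t s Ht Hs; rewrite S_INR in Hs.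
        generalize (Hshort t s Ht ltac:(lra)); lra.
      + assert (Hpos : 0 < INR m * eta).
        { assert (0 <= INR m * eta); [|lra].
          apply Rmult_le_pos; [apply pos_INR|unfold eta; lra]. }
        destruct (proj1 (is_lim_p_infty_0_iff _) (Hlim _ Hpos) (eps / 3))
          as [T' [HT'0 HT']]; [lra|].
        exists (T + T' + (INR n + alpha)); split;
          [generalize (pos_INR n); lra|].
        intros t s Ht Hs; rewrite S_INR in Hs.
        generalize (pos_INR n); intros Hn.
        destruct (Rle_dec s (INR m * eta)) as [Hle|Hgt].
        * apply HT; lra.
        * generalize (HT' t ltac:(lra))
            (Hshort (t + INR m * eta) (s - INR m * eta) ltac:(lra) ltac:(lra)).
          replace (t + INR m * eta + (s - INR m * eta)) with (t + s) by ring.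
          intros Ha Hb; apply Rabs_le_between in Ha; apply Rabs_le_between in Hb.
          apply Rabs_le_between; lra. }
  assert (Heta : 0 < eta) by (unfold eta; lra).
  destruct (nfloor_ex (1 / eta)) as [m Hm].
  { apply Rdiv_le_0_compat; lra. }
  destruct (Hmany (S m)) as [T [HT0 HT]].
  exists T; split; auto; intros t s Ht Hs; apply HT; auto.
  rewrite S_INR.
  destruct Hm as [_ Hm].
  apply (Rmult_lt_compat_r eta) in Hm; auto.
  replace (1 / eta * eta) with 1 in Hm by (field; lra); lra.
Qed.

(** * Splitting the forcing term *)

Lemma is_derive_RInt_0 (u : R -> R) (t : R) :
  (forall s, continuous u s) -> is_derive (fun t => RInt u 0 t) t (u t).
Proof.
intros Hc.
apply (is_derive_RInt u (fun t => RInt u 0 t) 0); auto.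
apply filter_forall; intros s.
apply (RInt_correct (V := R_CompleteNormedModule)).
now apply ex_RInt_everywhere_continuous.
Qed.

Lemma RInt_0_increment (u : R -> R) (t s : R) :
  (forall r, continuous u r) -> RInt u 0 s - RInt u 0 t = RInt u t s.
Proof.
intros Hc.
rewrite <- (RInt_Chasles (V := R_CompleteNormedModule) u 0 t s)
  by now apply ex_RInt_everywhere_continuous.
change (RInt u 0 t + RInt u t s - RInt u 0 t = RInt u t s); ring.
Qed.

(** Subtracting from the primitive [F] of [f] its moving average leaves a
    vanishing [p], by uniformity of the increments of [F] over [[0, 1]]; the
    derivative [g] of the moving average is an increment of [F]. *)
Lemma vanishing_windows_decomposition (f : R -> R) :
  (forall t, continuous f t) ->
  (forall theta, 0 < theta ->
     is_lim (fun t => RInt f t (t + theta)) p_infty 0) ->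
  exists p g : R -> R,
    (forall t, is_derive p t (f t - g t)) /\ (forall t, continuous g t) /\
    is_lim p p_infty 0 /\ is_lim g p_infty 0.
Proof.
intros Hf HB.
set (F := fun t => RInt f 0 t).
set (Q := fun t => RInt F 0 t).
assert (HF : forall t, is_derive F t (f t)).
{ intros t; now apply is_derive_RInt_0. }
assert (HFc : forall t, continuous F t).
{ intros t; apply (ex_derive_continuous F); exists (f t); apply HF. }
assert (HQ : forall t, is_derive Q t (F t)).
{ intros t; now apply is_derive_RInt_0. }
assert (HFlim : forall theta, 0 < theta ->
  is_lim (fun t => F (t + theta) - F t) p_infty 0).
{ intros theta Hth; apply is_lim_ext with (2 := HB theta Hth).
  intros t; symmetry; now apply RInt_0_increment. }
exists (fun t => F t - (Q (t + 1) - Q t)), (fun t => F (t + 1) - F t).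
split; [|split; [|split]].
- intros t; auto_derive.
  + repeat split; eexists; eauto.
  + replace (Derive (fun x => F x) t) with (f t)
      by (symmetry; now apply is_derive_unique).
    replace (Derive (fun x => Q x) (t + 1)) with (F (t + 1))
      by (symmetry; now apply is_derive_unique).
    replace (Derive (fun x => Q x) t) with (F t)
      by (symmetry; now apply is_derive_unique).
    ring.
- intros t; apply (continuous_minus (fun t => F (t + 1)) F); auto.
  apply (continuous_ext (fun t => F (1 * t + 1))).
  + intros r; f_equal; ring.
  + now apply continuous_comp_affine.
- apply is_lim_p_infty_0_iff; intros eps Heps.
  destruct (increments_vanish_uniformly F HFc HFlim eps Heps) as [T [HT0 HT]].
  exists T; split; auto; intros t Ht.
  assert (Heq : Q (t + 1) - Q t - F t = RInt (fun s => F s - F t) t (t + 1)).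
  { unfold Q; rewrite RInt_0_increment by auto.
    rewrite (RInt_minus (V := R_CompleteNormedModule) F (fun _ => F t)).
    - rewrite RInt_const; unfold minus, plus, opp, scal; simpl.
      unfold mult; simpl; ring.
    - now apply ex_RInt_everywhere_continuous.
    - apply ex_RInt_const. }
  rewrite Rabs_minus_sym, Heq.
  replace eps with ((t + 1 - t) * eps) by ring.
  apply continuous_abs_RInt_le_const; [lra| |].
  + intros s; apply (continuous_minus F (fun _ => F t)); auto.
    apply continuous_const.
  + intros s Hs; replace s with (t + (s - t)) by ring; apply HT; lra.
- apply HFlim; lra.
Qed.

(** * Characterisation of the solutions that tend to zero *)

(** For the direct implication, removing from [x] the part [p] of the forcing
    that is a derivative leaves only vanishing forcing; for the converse, [f] is
    recovered from [x] by integrating the equation. *)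
Lemma pantograph_tends_to_zero_iff (q a b : R) (x f : R -> R) :
  0 < q < 1 -> b < 0 -> Rabs a < - b ->
  (forall t, continuous x t) -> (forall t, continuous f t) ->
  (forall t, 0 < t -> is_derive x t (a * x (q * t) + b * x t + f t)) ->
  ((forall theta, 0 < theta ->
      is_lim (fun t => RInt f t (t + theta)) p_infty 0) <->
   is_lim x p_infty 0).
Proof.
intros Hq Hb Hab Hx Hf Hd.
assert (Hdelay : forall u, (forall t, continuous u t) ->
  forall t, continuous (fun t => a * u (q * t) + b * u t) t).
{ intros u Hu t.
  apply (continuous_plus (fun t => a * u (q * t)) (fun t => b * u t)).
  - apply (continuous_scal_r a (fun t => u (q * t))).
    apply (continuous_ext (fun t => u (q * t + 0))).
    + intros r; f_equal; ring.
    + now apply continuous_comp_affine.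
  - apply (continuous_scal_r b u); auto. }
assert (Hdelay_lim : forall u, is_lim u p_infty 0 ->
  is_lim (fun t => a * u (q * t) + b * u t) p_infty 0).
{ intros u Hu; apply is_lim_p_infty_0_iff; intros eps Heps.
  destruct (proj1 (is_lim_p_infty_0_iff u) Hu (eps / (2 * - b)))
    as [T [HT0 HT]].
  { apply Rdiv_lt_0_compat; lra. }
  assert (HTq : T <= T / q).
  { apply Rle_div_r; [lra|]; nra. }
  exists (T / q); split; [lra|]; intros t Ht.
  apply Rle_trans with (1 := Rabs_triang _ _).
  rewrite !Rabs_mult, (Rabs_left b) by exact Hb.
  assert (Hqt : T <= q * t).
  { replace T with (q * (T / q)) by (field; lra).
    apply Rmult_le_compat_l; lra. }
  generalize (HT _ Hqt) (HT t ltac:(lra)) (Rabs_pos a)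
    (Rabs_pos (u (q * t))); intros.
  apply Rle_trans with (- b * (eps / (2 * - b)) + - b * (eps / (2 * - b))).
  - apply Rplus_le_compat; apply Rmult_le_compat; try lra; apply Rabs_pos.
  - right; field; lra. }
split; intros H.
- destruct (vanishing_windows_decomposition f Hf H)
    as [p [g [Hp [Hg [Hp0 Hg0]]]]].
  assert (Hpc : forall t, continuous p t).
  { intros t; apply (ex_derive_continuous p); eexists; apply Hp. }
  set (h := fun t => a * p (q * t) + b * p t + g t).
  assert (Hz : is_lim (fun t => x t - p t) p_infty 0).
  { apply (pantograph_vanishing_forcing q a b _ h); auto.
    - intros t; now apply (continuous_minus x p).
    - intros t.
      apply (continuous_plus (fun t => a * p (q * t) + b * p t) g);
        [exact (Hdelay p Hpc t)|apply Hg].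
    - intros t Ht.
      replace (a * (x (q * t) - p (q * t)) + b * (x t - p t) + h t)
        with (a * x (q * t) + b * x t + f t - (f t - g t))
        by (unfold h; ring).
      apply (is_derive_minus x p); auto.
    - replace (Finite 0) with (Finite (0 + 0)) by (f_equal; ring).
      apply (is_lim_plus' (fun t => a * p (q * t) + b * p t) g); auto. }
  apply is_lim_ext with (fun t => (x t - p t) + p t); [intros t; ring|].
  replace (Finite 0) with (Finite (0 + 0)) by (f_equal; ring).
  now apply is_lim_plus'.
- intros theta Hth.
  set (h := fun t => a * x (q * t) + b * x t).
  assert (Hh : forall t, continuous h t) by now apply Hdelay.
  apply (is_lim_ext_loc
    (fun t => (x (t + theta) - x t) - RInt h t (t + theta))).
  { exists 0; intros t Ht.
    assert (Hi : is_RInt (fun s => plus (h s) (f s)) t (t + theta)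
                         (minus (x (t + theta)) (x t))).
    { apply (is_RInt_derive x); rewrite Rmin_left, Rmax_right by lra;
        intros s Hs.
      - apply Hd; lra.
      - now apply (continuous_plus h f). }
    apply (is_RInt_unique (V := R_CompleteNormedModule)) in Hi.
    rewrite (RInt_plus (V := R_CompleteNormedModule)) in Hi
      by now apply ex_RInt_everywhere_continuous.
    unfold plus, minus, opp in Hi; simpl in Hi.
    unfold plus, opp in Hi; simpl in Hi; lra. }
  replace (Finite 0) with (Finite ((0 - 0) - 0)) by (f_equal; ring).
  apply is_lim_minus'; [apply is_lim_minus'; [|exact H]|].
  + apply is_lim_p_infty_0_iff; intros eps Heps.
    destruct (proj1 (is_lim_p_infty_0_iff x) H eps Heps) as [T [HT0 HT]].
    exists T; split; auto; intros t Ht; apply HT; lra.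
  + apply RInt_window_vanishes; auto.
    now apply Hdelay_lim.
Qed.

(** * From the half-line to the real line *)

(** Extension by the constant [u 0] turns continuity on the half-line into
    two-sided continuity, as asked by the mean value theorem and by the
    integrability lemmas. *)
Definition extend_left (u : R -> R) (t : R) : R := u (Rmax 0 t).

Lemma extend_left_eq (u : R -> R) (t : R) : 0 <= t -> extend_left u t = u t.
Proof. intros Ht; unfold extend_left; now rewrite Rmax_right. Qed.

Lemma extend_left_continuous (u : R -> R) :
  continuous_on halfline u -> forall t, continuous (extend_left u) t.
Proof.
intros Hu t.
assert (H0 : 0 <= Rmax 0 t) by apply Rmax_l.
intros P HP; unfold filtermap, extend_left in *.
assert (Hw := Hu (Rmax 0 t) H0 P HP); unfold filtermap, within in Hw.
assert (Hm : continuous (Rmax 0) t).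
{ apply (continuous_ext (fun s => (s + Rabs s) / 2)).
  - intros s; unfold Rmax, Rabs; destruct (Rle_dec 0 s), (Rcase_abs s); lra.
  - apply (continuous_scal_l (fun s => s + Rabs s) (/ 2)).
    apply (continuous_plus (fun s => s) Rabs); [apply continuous_id|].
    apply continuity_pt_filterlim, Rcontinuity_abs. }
assert (Hmw := Hm _ Hw); unfold filtermap in Hmw.
revert Hmw; apply filter_imp.
intros s Hs; apply Hs, Rmax_l.
Qed.

Lemma extend_left_derive (u : R -> R) (t l : R) :
  0 < t -> is_derive_halfline u t l -> is_derive (extend_left u) t l.
Proof.
intros Ht [Hlin Hdom].
assert (Hpos : locally t (fun s => 0 < s)) by now apply (open_gt 0).
apply (is_derive_ext_loc u).
- generalize Hpos; apply filter_imp; intros s Hs.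
  symmetry; apply extend_left_eq; lra.
- split; [exact Hlin|].
  intros t' Ht' eps.
  rewrite <- (is_filter_lim_locally_unique (V := R_NormedModule) t t' Ht').
  assert (Hlim : is_filter_lim (within halfline (locally t)) t).
  { intros P HP; unfold within; generalize HP; apply filter_imp; auto. }
  generalize (Hdom t Hlim eps); unfold within.
  intros Hw; generalize (filter_and _ _ Hpos Hw); apply filter_imp.
  intros s [Hs1 Hs2]; apply Hs2; unfold halfline; lra.
Qed.

Lemma is_lim_extend_left (u : R -> R) (l : Rbar) :
  is_lim (extend_left u) p_infty l <-> is_lim u p_infty l.
Proof.
split; apply is_lim_ext_loc; exists 0; intros t Ht;
  [|symmetry]; apply extend_left_eq; lra.
Qed.

Lemma halfline_tends_to_zero_iff (q a b : R) (x f : R -> R) :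
  0 < q < 1 -> b < 0 -> Rabs a < - b ->
  continuous_on halfline x -> continuous_on halfline f ->
  (forall t, 0 <= t -> is_derive_halfline x t (a * x (q * t) + b * x t + f t)) ->
  ((forall theta, 0 < theta ->
      is_lim (fun t => RInt f t (t + theta)) p_infty 0) <->
   is_lim x p_infty 0).
Proof.
intros Hq Hb Hab Hx Hf Hd.
assert (Hiff := pantograph_tends_to_zero_iff q a b (extend_left x)
  (extend_left f) Hq Hb Hab (extend_left_continuous x Hx)
  (extend_left_continuous f Hf)).
rewrite is_lim_extend_left in Hiff.
rewrite <- Hiff.
- assert (Hw : forall theta, 0 < theta -> forall t, 0 < t ->
    RInt (extend_left f) t (t + theta) = RInt f t (t + theta)).
  { intros theta Hth t Ht; apply RInt_ext.
    rewrite Rmin_left, Rmax_right by lra; intros s Hs.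
    apply extend_left_eq; lra. }
  split; intros H theta Hth; generalize (H theta Hth); apply is_lim_ext_loc;
    exists 0; intros t Ht; [symmetry|]; now apply Hw.
- intros t Ht.
  rewrite !extend_left_eq by nra.
  apply extend_left_derive; auto; apply Hd; lra.
Qed.

Theorem theorem5 (q a b : R) (hq : 0 < q < 1) (ha : a <> 0) (hb : b < 0)
    (hab : Rabs a < Rabs b)
    (f : R -> R) (hf : continuous_on halfline f) (zeta : R)
    (x : R -> R) (hx : pantograph_solution q a b f zeta x)
    (y : R -> R) (hy : relaxation_solution f y) :
  (is_lim y p_infty 0 <->
   (forall theta : R, 0 < theta ->
      is_lim (fun t => RInt f t (t + theta)) p_infty 0)) /\
  ((forall theta : R, 0 < theta ->
      is_lim (fun t => RInt f t (t + theta)) p_infty 0) <->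
   is_lim x p_infty 0).
Proof.
destruct hx as [hxc [hxd _]], hy as [hyc [hyd _]].
split.
- symmetry.
  apply (halfline_tends_to_zero_iff q 0 (-1)); auto; try lra.
  + rewrite Rabs_R0; lra.
  + intros t ht.
    replace (0 * y (q * t) + -1 * y t + f t) with (- y t + f t) by ring.
    now apply hyd.
- apply (halfline_tends_to_zero_iff q a b); auto.
  now rewrite <- (Rabs_left b).
Qed.
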